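(* Let $G$ be a $d$-regular graph on $n$ vertices, let $\mu=\mu(G)$, and let $C$ be an $[n,r_0n,\delta_0n]$ code over $\mathbb F_q$. Then the expander code $\mathcal C_{\mathrm{exp}}=\phi_{\mathrm{exp}}(C)$ is a code over $\mathbb F_{q^d}$ of length $n$, of rate $\dfrac{r_0}{d}$, and with minimum distance at least $$\frac{d^2\,\delta_0\,n}{\delta_0(d^2-\mu^2)+\mu^2}.$$
   Context: Graphs are finite, simple and undirected, with $n\ge 2$ vertices and $d\ge1$. For a graph $G$ on $n$ vertices with adjacency matrix $A$ and eigenvalues $\lambda_0\ge\lambda_1\ge\cdots\ge\lambda_{n-1}$ of $A$ (with multiplicity), $\mu(G)=\max\{\lambda_1,|\lambda_{n-1}|\}$. An $[n,k,D]$ code over $\mathbb F_q$ is a $k$-dimensional $\mathbb F_q$-linear subspace of $\mathbb F_q^n$ with minimum Hamming distance $D$. Expander code: label the vertices of $G$ by $1,\dots,n$. For each vertex $i$ let $l_1(i),\dots,l_d(i)$ be the $d$ vertices adjacent to $i$, in some prespecified order. Identify $\mathbb F_{q^d}$ with $\mathbb F_q^d$ (as $\mathbb F_q$-vector spaces). The map $\phi_{\mathrm{exp}}:\mathbb F_q^n\to\mathbb F_{q^d}^n$ sends $[a_1,\dots,a_n]$ to $[\alpha_1,\dots,\alpha_n]$ with $\alpha_i=[a_{l_1(i)},a_{l_2(i)},\dots,a_{l_d(i)}]$. The expander code is $\mathcal C_{\mathrm{exp}}=\phi_{\mathrm{exp}}(C)$; it need not be $\mathbb F_{q^d}$-linear.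 Its minimum distance is the minimum Hamming distance (number of coordinates in $\mathbb F_{q^d}$ that differ) between distinct codewords, and its rate is $\frac{1}{n}\log_{q^d}|\mathcal C_{\mathrm{exp}}|$. *)

(* Defs.v *)
From HB Require Import structures.
From mathcomp Require Import all_boot all_order all_algebra.
From mathcomp Require Import sesquilinear spectral.
From mathcomp Require Import polyrcf complex.
From mathcomp Require Import reals exp.

Set Implicit Arguments.
Unset Strict Implicit.
Unset Printing Implicit Defensive.

Import Order.TTheory GRing.Theory Num.Theory.
Local Open Scope ring_scope.

Section Graphs.
Variables (n : nat) (e : rel 'I_n).

Definition simple_graph : Prop := symmetric e /\ irreflexive e.

Definition regular_graph (d : nat) : Prop :=
  forall i : 'I_n, #|[set j | e i j]| = d.

Definition adjacency (R : nzRingType) : 'M[R]_n := \matrix_(i, j) (e i j)%:R.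

(* [nbr i] lists the vertices adjacent to [i], each exactly once. *)
Definition neighbor_order (d : nat) (nbr : 'I_n -> d.-tuple 'I_n) : Prop :=
  forall i, uniq (nbr i) /\ forall j, (j \in nbr i) = e i j.

End Graphs.

(* The eigenvalues of A lying in R, in nonincreasing order, each repeated
   according to its multiplicity as a root of the characteristic polynomial.
   By [eigenvaluesP], this is the whole spectrum when A is symmetric. *)
Definition eigenvalues (R : rcfType) (n : nat) (A : 'M[R]_n) : seq R :=
  sort >=%R (flatten [seq nseq (mup x (char_poly A)) x
                     | x <- rootsR (char_poly A)]).

Lemma spectrum_exists (R : rcfType) n (A : 'M[R]_n) : A^T = A ->
  exists s : 'I_n -> R, char_poly A = \prod_i ('X - (s i)%:P).
Proof.
move=> symA; pose f := real_complex R.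
have fr x : f x \is Num.real by rewrite complex_real.
have hA : map_mx f A \is hermsymmx.
  apply: realsym_hermsym.
    apply/is_hermitianmxP; rewrite expr0 scale1r map_mx_id //.
    by rewrite -{1}symA map_trmx.
  by apply/mxOverP => i j; rewrite mxE.
have nA := hermitian_normalmx hA.
have /mxOverP rD := hermitian_spectral_diag_real hA.
have /orthomx_spectralP eqA := nA.
set P := spectralmx _ in eqA; set D := spectral_diag _ in eqA rD.
have uP : P \in unitmx by apply: spectral_unit.
have cp : char_poly (map_mx f A) = char_poly (diag_mx D).
  rewrite eqA /char_poly.
  have -> : char_poly_mx (invmx P *m diag_mx D *m P) =
     map_mx polyC (invmx P) *m char_poly_mx (diag_mx D) *m map_mx polyC P.
    rewrite /char_poly_mx mulmxBr mulmxBl -!map_mxM; congr (_ - _).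
    by rewrite -scalemx1 -scalemxAr -scalemxAl mulmx1 -map_mxM mulVmx // map_mx1.
  rewrite !det_mulmx mulrAC -det_mulmx -map_mxM mulVmx // map_mx1 det1 mul1r //.
rewrite (char_poly_trig (diag_mx_is_trig D)) in cp.
exists (fun i => complex.Re (D 0 i)).
apply: (@map_inj_poly _ _ f) => //; first exact: complexI.
rewrite map_char_poly cp rmorph_prod; apply: eq_bigr => i _.
rewrite mxE eqxx mulr1n rmorphB /= map_polyX map_polyC /=; congr ('X - _%:P).
by rewrite -[LHS]RRe_real //; apply: rD.
Qed.

Lemma eigenvaluesP (R : rcfType) n (A : 'M[R]_n) : A^T = A ->
  [/\ sorted >=%R (eigenvalues A), size (eigenvalues A) = n
    & char_poly A = \prod_(x <- eigenvalues A) ('X - x%:P)].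
Proof.
move=> /spectrum_exists [s cp].
pose t := [seq s i | i <- enum 'I_n].
have cpt : char_poly A = \prod_(x <- t) ('X - x%:P) by rewrite cp big_map big_enum.
have nz : char_poly A != 0 by rewrite monic_neq0 // char_poly_monic.
have ps : perm_eq (eigenvalues A) t.
  rewrite /eigenvalues perm_sort; apply/allP => x _ /=; apply/eqP.
  rewrite -[RHS]mu_prod_XsubC -cpt count_flatten -map_comp.
  have h : root (char_poly A) x = (x \in rootsR (char_poly A)).
    by have := roots_on_rootsR nz x; rewrite inE /=.
  rewrite (eq_map (g := fun y => if y == x then mup x (char_poly A) else 0%N));
    last first.
    move=> y /=; rewrite count_nseq /=; case: eqP => [->|]; last by rewrite mul0n.
    by rewrite mul1n.
  have [xr|xr] := boolP (x \in rootsR (char_poly A)).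
    rewrite sumnE big_map -big_mkcond /= big_const_seq.
    rewrite (count_uniq_mem x) ?xr //= ?addn0 //.
    by apply: uniq_roots.
  rewrite mupNroot ?h // sumnE big_map big1_seq // => i /= ir.
  by case: eqP => // eix; rewrite -eix ir in xr.
split; last by rewrite cpt; apply: perm_big; rewrite perm_sym.
  by apply: sort_sorted => x y; apply: ge_total.
by rewrite (perm_size ps) size_map size_enum_ord.
Qed.

Definition graph_mu (R : rcfType) (n : nat) (e : rel 'I_n) : R :=
  let lam := eigenvalues (adjacency e R) in
  Num.max lam`_1 `|lam`_n.-1|.

Section Codes.
Variables (K : finType) (n : nat).

Definition hamming_dist (x y : 'rV[K]_n) : nat := #|[set i | x 0 i != y 0 i]|.

(* The minimum is required to be attained, so a code with fewer than two
   codewords has no minimum distance. *)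
Definition has_min_dist (C : {set 'rV[K]_n}) (D : nat) : Prop :=
  (exists x y, [/\ x \in C, y \in C, x != y & hamming_dist x y = D]) /\
  (forall x y, x \in C -> y \in C -> x != y -> (D <= hamming_dist x y)%N).

Definition code_rate (R : realType) (C : {set 'rV[K]_n}) : R :=
  (ln #|C|%:R / ln #|K|%:R) / n%:R.

End Codes.

Definition linear_code (F : finFieldType) (n : nat) (C : {vspace 'rV[F]_n})
    (k D : nat) : Prop :=
  \dim C = k /\ has_min_dist [set c in C] D.

Section ExpanderCode.
Variables (F L : finFieldType) (n d : nat).
Variables (theta : 'rV[F]_d -> L) (nbr : 'I_n -> d.-tuple 'I_n).

(* [theta] is the identification of F^d with the degree-d extension L of F. *)
Definition phi_exp (a : 'rV[F]_n) : 'rV[L]_n :=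
  \row_i theta (\row_j a 0 (tnth (nbr i) j)).

Definition expander_code (C : {vspace 'rV[F]_n}) : {set 'rV[L]_n} :=
  [set phi_exp a | a in C].

End ExpanderCode.

(* Main.v *)
(* If two words of C differ exactly on S, their images differ exactly on the set
   N(S) of vertices with a neighbour in S, so the distance bound is Tanner's
   expansion inequality: A 1_S is supported on N(S) and has total weight d |S|,
   while its squared norm is at most d^2 |S|^2 / n + mu^2 (|S| - |S|^2 / n),
   so Cauchy-Schwarz bounds |N(S)| from below. The norm bound comes from the
   spectral theorem applied to B = A - (d/n) J, which agrees with A on vectors of
   zero sum: comparing characteristic polynomials, the nonzero eigenvalues of B
   are those of A with one copy of d removed, hence at most mu in absolute
   value. *)

Require Import Defs.
From HB Require Import structures.
From mathcomp Require Import all_boot all_order all_algebra.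
From mathcomp Require Import finfield.
From mathcomp Require Import sesquilinear spectral.
From mathcomp Require Import complex.
From mathcomp Require Import reals exp.
From mathcomp Require Import ring.

Set Implicit Arguments.
Unset Strict Implicit.
Unset Printing Implicit Defensive.

Import Order.TTheory GRing.Theory Num.Theory.
Local Open Scope ring_scope.

(** * Norm bounds from the spectral theorem *)

Lemma mulmx_trmxC_sqnorm (C : numClosedFieldType) n (y : 'rV[C]_n) :
  (y *m (y^t*)%sesqui) 0 0 = \sum_i `|y 0 i| ^+ 2.
Proof. by rewrite mxE; apply: eq_bigr => i _; rewrite !mxE normCK. Qed.

Lemma unitarymx_sqnorm (C : numClosedFieldType) n (P : 'M[C]_n) (y : 'rV[C]_n) :
  P \is unitarymx -> \sum_i `|(y *m P) 0 i| ^+ 2 = \sum_i `|y 0 i| ^+ 2.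
Proof.
move=> uP; rewrite -!mulmx_trmxC_sqnorm trmx_mul map_mxM mulmxA.
by rewrite mulmxtVK.
Qed.

(** From [P A = D P], row [i] of the invertible matrix [P] is an eigenvector. *)
Lemma spectral_diag_eigenvalue (C : numClosedFieldType) n (A : 'M[C]_n) i :
  A \is normalmx -> eigenvalue A (spectral_diag A 0 i).
Proof.
move=> /orthomx_spectralP; set P := spectralmx A; set D := spectral_diag A.
move=> eqA; have uP : P \in unitmx by apply: spectral_unit.
apply/eigenvalueP; exists (row i P).
  rewrite [in LHS]eqA !mulmxA -row_mul mulmxV // row1 -rowE.
  by rewrite row_diag_mx -scalemxAl -rowE.
apply/negP => /eqP /(congr1 (fun v => v *m invmx P)).
rewrite -row_mul mul0mx mulmxV // => /rowP /(_ i); rewrite !mxE eqxx => /eqP.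
by rewrite oner_eq0.
Qed.

(** A unitary change of basis preserves the norm and makes [A] diagonal, so each coordinate is
    scaled by at most [m]. *)
Lemma normalmx_sqnorm_le (C : numClosedFieldType) n (A : 'M[C]_n) (m : C) :
  A \is normalmx -> 0 <= m -> (forall i, `|spectral_diag A 0 i| <= m) ->
  forall y : 'rV_n,
    \sum_i `|(y *m A) 0 i| ^+ 2 <= m ^+ 2 * \sum_i `|y 0 i| ^+ 2.
Proof.
move=> /orthomx_spectralP; set P := spectralmx A; set D := spectral_diag A.
move=> eqA m0 hD y; have uP : P \is unitarymx by apply: spectral_unitarymx.
rewrite eqA !mulmxA unitarymx_sqnorm // invmx_unitary //.
set z := y *m _.
have -> : \sum_i `|y 0 i| ^+ 2 = \sum_i `|z 0 i| ^+ 2.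
  by rewrite unitarymx_sqnorm // trmxC_unitary.
rewrite mulr_sumr; apply: ler_sum => i _.
rewrite mul_mx_diag mxE normrM exprMn mulrC ler_wpM2r ?exprn_ge0 //.
by rewrite lerXn2r ?nnegrE.
Qed.

(** Over [R[i]] the matrix is hermitian, hence normal, with real spectral diagonal; the diagonal
    entries thus come from roots of the characteristic polynomial over [R]. *)
Lemma symmx_sqnorm_le (R : rcfType) n (A : 'M[R]_n) (m : R) :
  A^T = A -> 0 <= m -> (forall x, root (char_poly A) x -> `|x| <= m) ->
  forall y : 'rV_n,
    \sum_i (y *m A) 0 i ^+ 2 <= m ^+ 2 * \sum_i y 0 i ^+ 2.
Proof.
move=> symA m0 hm y; pose f : {rmorphism R -> R[i]%C} := real_complex R.
have fr x : f x \is Num.real by rewrite complex_real.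
have hA : map_mx f A \is hermsymmx.
  apply: realsym_hermsym.
    apply/is_hermitianmxP; rewrite expr0 scale1r map_mx_id //.
    by rewrite -{1}symA map_trmx.
  by apply/mxOverP => i j; rewrite mxE.
have nA := hermitian_normalmx hA.
have /mxOverP rD := hermitian_spectral_diag_real hA.
have norm_f x : `|f x| = f `|x|.
  by rewrite normc_def /= expr0n addr0 sqrtr_sqr.
have sq (v : 'rV_n) : \sum_i `|(map_mx f v) 0 i| ^+ 2 = f (\sum_i v 0 i ^+ 2).
  rewrite rmorph_sum; apply: eq_bigr => i _.
  by rewrite mxE norm_f -rmorphXn /= real_normK ?num_real.
have := normalmx_sqnorm_le (m := f m) nA.
rewrite ler0c => /(_ m0) h; have {h} := h _ (map_mx f y).
rewrite -map_mxM !sq -rmorphXn -rmorphM lecR; apply => i.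
have := spectral_diag_eigenvalue i nA; rewrite -(RRe_real (rD 0 i)).
rewrite eigenvalue_root_char -map_char_poly fmorph_root => /hm.
by rewrite norm_f lecR.
Qed.

(* (X - A)(X - B) = X (X - (A + B)) when AB = 0. *)
Lemma char_poly_add_ortho (R : comNzRingType) n (A B : 'M[R]_n) : A *m B = 0 ->
  char_poly A * char_poly B = 'X^n * char_poly (A + B).
Proof.
move=> AB0; rewrite /char_poly -det_mulmx -detZ; congr (\det _).
rewrite /char_poly_mx mulmxBl !mulmxBr -map_mxM AB0 map_mx0 subr0.
rewrite !mul_scalar_mx mul_mx_scalar -!scalerBr map_mxD opprD addrA.
by rewrite addrAC.
Qed.

Lemma char_poly_neq0 (R : nzRingType) n (A : 'M[R]_n) : char_poly A != 0.
Proof. exact: monic_neq0 (char_poly_monic A). Qed.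

(** The extra factor ['X^n] only affects the multiplicity of 0. *)
Lemma mup_char_poly_add_ortho (F : fieldType) n (A B : 'M[F]_n) (x : F) :
  A *m B = 0 -> x != 0 ->
  mup x (char_poly (A + B)) = (mup x (char_poly A) + mup x (char_poly B))%N.
Proof.
move=> AB0 x0; rewrite -mupM ?char_poly_neq0 // char_poly_add_ortho //.
by rewrite mupMr // rootE hornerXn expf_neq0.
Qed.

Lemma sum_sqrB (R : comNzRingType) (I : finType) (P : pred I) (w : I -> R) a :
  \sum_(i | P i) (w i - a) ^+ 2 =
  \sum_(i | P i) w i ^+ 2 - a *+ 2 * \sum_(i | P i) w i + a ^+ 2 * \sum_(i | P i) 1.
Proof.
rewrite !mulr_sumr -sumrB -big_split /=; apply: eq_bigr => i _.
by ring.
Qed.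

Lemma path_ge_last (disp : Order.disp_t) (T : porderType disp) (a x : T) s :
  path >=%O a s -> x \in a :: s -> (last a s <= x)%O.
Proof.
elim: s a x => [|b s IH] a x /=; first by rewrite inE => _ /eqP ->.
move=> /andP [ba ps] /predU1P [->|]; last exact: IH.
by apply: le_trans ba; apply: IH ps _; rewrite mem_head.
Qed.

(** * Spectrum of a regular graph and of its deflation *)

Section RegularGraph.
Variables (R : rcfType) (n d : nat) (e : rel 'I_n).
Hypotheses (n_ge2 : (2 <= n)%N) (d_gt0 : (0 < d)%N).
Hypotheses (sge : simple_graph e) (rge : regular_graph e d).

Let A : 'M[R]_n := adjacency e R.
Let J : 'M[R]_n := const_mx (d%:R / n%:R).
Let B := A - J.
Let mu : R := graph_mu R e.

Let n0 : n%:R != 0 :> R. Proof. by rewrite pnatr_eq0; case: (n) n_ge2. Qed.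
Let d0 : d%:R != 0 :> R. Proof. by rewrite pnatr_eq0 -lt0n. Qed.

Lemma adjacency_sym : A^T = A.
Proof. by apply/matrixP => i j; rewrite !mxE sge.1. Qed.

Lemma sum_adjacency_row i : \sum_j A i j = d%:R.
Proof.
rewrite -(rge i) -sum1_card natr_sum [RHS]big_mkcond /=.
by apply: eq_bigr => j _; rewrite mxE inE; case: (e i j).
Qed.

Lemma adjacency_const a : A *m const_mx a = const_mx (d%:R * a) :> 'M_n.
Proof.
apply/matrixP => i j; rewrite !mxE -(sum_adjacency_row i) mulr_suml.
by apply: eq_bigr => k _; rewrite !mxE.
Qed.

Lemma deflated_adjacency_const a : B *m const_mx a = 0 :> 'M_n.
Proof.
rewrite mulmxBl adjacency_const; apply/matrixP => i j; rewrite !mxE.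
under eq_bigr do rewrite !mxE.
by rewrite sumr_const card_ord -mulr_natr; field.
Qed.

(** Sum the absolute values of the entries of [v A = x v]: the triangle inequality and the row sums
    [d] bound the total by [d] times that of [v]. *)
Lemma regular_eigenvalue_le x : eigenvalue A x -> `|x| <= d%:R.
Proof.
move=> /eigenvalueP [v vA v0].
have s0 : 0 < \sum_i `|v 0 i|.
  rewrite lt_def sumr_ge0 // andbT; apply: contraNneq v0 => s0.
  apply/eqP/rowP => i; rewrite mxE; apply/eqP; rewrite -normr_eq0.
  by move/eqP: s0; rewrite psumr_eq0 // => /allP; apply; rewrite mem_index_enum.
rewrite -(ler_pM2r s0) mulr_sumr.
have -> : \sum_i `|x| * `|v 0 i| = \sum_i `|\sum_j v 0 j * A j i|.
  apply: eq_bigr => i _; rewrite -normrM; congr `|_|.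
  by move/rowP: vA => /(_ i); rewrite mxE [RHS]mxE.
apply: le_trans (_ : \sum_i \sum_j `|v 0 j| * A j i <= _).
  apply: ler_sum => i _; apply: le_trans (ler_norm_sum _ _ _) _.
  by apply: ler_sum => j _; rewrite normrM mxE normr_nat.
rewrite exchange_big mulr_sumr; apply: ler_sum => j _.
by rewrite -mulr_sumr sum_adjacency_row mulrC.
Qed.

Lemma const_mx_eigenvalue : eigenvalue J d%:R.
Proof.
apply/eigenvalueP; exists (const_mx 1).
  apply/rowP => i; rewrite !mxE; under eq_bigr do rewrite !mxE mul1r.
  by rewrite sumr_const card_ord -mulr_natr mulr1; field.
by apply/eqP => /rowP /(_ (Ordinal n_ge2)); rewrite !mxE => /eqP; rewrite oner_eq0.
Qed.

(** Past the head, a nonnegative eigenvalue is at most the second one, and a negative one is bounded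
    in absolute value by the last. *)
Lemma graph_mu_behead x : x \in behead (eigenvalues A) -> `|x| <= mu.
Proof.
have [] := eigenvaluesP adjacency_sym; rewrite /mu /graph_mu -/A.
case: (eigenvalues A) => [|a [|b l]] //= /andP [_ sl] sz _ xl.
have xb : x <= b.
  move: xl; rewrite inE => /predU1P [-> //|xl].
  by move: sl; rewrite (path_sortedE ge_trans) => /andP [/allP /(_ x xl)].
rewrite le_max /= -sz /=; have [x_ge0|x_lt0] := ger0P x; first by rewrite xb.
apply/orP; right; have <- : last b l = (b :: l)`_(size l) by rewrite nth_last.
have lx : last b l <= x.
  exact: path_ge_last.
by rewrite ler0_norm ?lerN2 // (le_trans lx) ?ltW.
Qed.

Lemma deflated_root_le x : root (char_poly B) x -> `|x| <= mu.
Proof.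
move=> rx.
have mu0 : 0 <= mu.
  by rewrite /mu /graph_mu /= le_max normr_ge0 orbT.
have [->|x0] := eqVneq x 0; first by rewrite normr0.
have BJ : B *m J = 0 by rewrite deflated_adjacency_const.
have AE : A = B + J by rewrite subrK.
have cnt y : y != 0 ->
    count_mem y (eigenvalues A) = (mup y (char_poly B) + mup y (char_poly J))%N.
  move=> y0; rewrite -mup_char_poly_add_ortho // -AE -mu_prod_XsubC.
  by have [_ _ <-] := eigenvaluesP adjacency_sym.
have mup0 y (p : {poly R}) : p != 0 -> root p y -> (0 < mup y p)%N.
  by move=> p0; rewrite mup_geq // expr1 -dvdp_XsubCl.
have rB : (0 < mup x (char_poly B))%N by rewrite mup0 ?char_poly_neq0.
have rJ : (0 < mup d%:R (char_poly J))%N.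
  by rewrite mup0 ?char_poly_neq0 // -eigenvalue_root_char const_mx_eigenvalue.
have xA : x \in eigenvalues A by rewrite -has_pred1 has_count cnt // ltn_addr.
have dA : d%:R \in eigenvalues A.
  by rewrite -has_pred1 has_count cnt // ltn_addl.
have xd : `|x| <= d%:R.
  apply: regular_eigenvalue_le; rewrite eigenvalue_root_char.
  by have [_ _ ->] := eigenvaluesP adjacency_sym; rewrite root_prod_XsubC.
apply: graph_mu_behead.
have [sA _ _] := eigenvaluesP adjacency_sym.
have := cnt _ x0; case: (eigenvalues A) sA xA dA => [|a l] //= sA xA dA.
(* An eigenvalue other than the largest lies in the tail; only [x] equal to the head [a] needs a
   multiplicity count. *)
have [ax|] := eqVneq a x; last first.
  by move=> ax _; move: xA; rewrite inE eq_sym (negPf ax).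
rewrite -has_pred1 has_count.
(* [d] is an eigenvalue of [A], so the head is at least [d], while [|x| <= d]. *)
have xdE : x = d%:R.
  apply/eqP; rewrite eq_le (le_trans (ler_norm x) xd) -ax /=.
  move: dA; rewrite inE => /predU1P [->|dl]; first exact: lexx.
  by move: sA; rewrite (path_sortedE ge_trans) => /andP [/allP /(_ _ dl)].
(* Both [B] and [J] contribute to the multiplicity of [d] in [A], so a copy remains after removing
   the head. *)
rewrite xdE in rB *; move: rB rJ.
by case: (mup _ _) => // p _; case: (mup _ _) => // q _; rewrite addnS => -[]; rewrite add0n => ->.
Qed.

(** [J] annihilates zero-sum vectors, so [A] can be replaced by [B]. *)
Lemma graph_mu_sqnorm_le (w : 'rV[R]_n) : \sum_i w 0 i = 0 ->
  \sum_i (w *m A) 0 i ^+ 2 <= mu ^+ 2 * \sum_i w 0 i ^+ 2.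
Proof.
move=> w0.
have -> : w *m A = w *m B.
  rewrite mulmxBr; suff -> : w *m J = 0 by rewrite subr0.
  apply/rowP => i; rewrite !mxE.
  by under eq_bigr do rewrite mxE; rewrite -mulr_suml w0 mul0r.
apply: symmx_sqnorm_le; last exact: deflated_root_le.
  by rewrite linearB /= adjacency_sym /J trmx_const.
by rewrite /mu /graph_mu /= le_max normr_ge0 orbT.
Qed.

End RegularGraph.

(** Cauchy-Schwarz on the support, obtained from the nonnegativity of the sum of squared deviations
    from the mean over [T]. *)
Lemma sum_sqr_le_support (R : realFieldType) (I : finType) (T : {set I})
  (w : I -> R) : (forall i, i \notin T -> w i = 0) ->
  (\sum_i w i) ^+ 2 <= #|T|%:R * \sum_i w i ^+ 2.
Proof.
move=> w0; have supp (g : R -> R) : g 0 = 0 ->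
    \sum_i g (w i) = \sum_(i in T) g (w i).
  move=> g0; rewrite [RHS]big_mkcond; apply: eq_bigr => i _.
  by case: ifPn => // /w0 ->.
rewrite (supp id) // (supp (fun x => x ^+ 2)) ?expr0n //.
set s := \sum_(i in T) w i; set q := \sum_(i in T) _.
have [T0|t0] := posnP #|T|.
  move/eqP: T0; rewrite cards_eq0 => /eqP T0.
  by rewrite /s T0 big_set0 cards0 expr0n mul0r.
have {}t0 : 0 < #|T|%:R :> R by rewrite ltr0n.
have : 0 <= \sum_(i in T) (w i - s / #|T|%:R) ^+ 2.
  by apply: sumr_ge0 => i _; apply: sqr_ge0.
rewrite sum_sqrB -/s -/q -(pmulr_rge0 _ t0) sumr_const.
suff -> : #|T|%:R * (q - (s / #|T|%:R) *+ 2 * s + (s / #|T|%:R) ^+ 2 * #|T|%:R)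
  = #|T|%:R * q - s ^+ 2 by rewrite subr_ge0.
by field; rewrite lt0r_neq0.
Qed.

(** * Vertex expansion *)

Definition neighborhood n (e : rel 'I_n) (S : {set 'I_n}) : {set 'I_n} :=
  [set i | [exists j in S, e i j]].

Section Expansion.
Variables (R : rcfType) (n d : nat) (e : rel 'I_n).
Hypotheses (n_ge2 : (2 <= n)%N) (d_gt0 : (0 < d)%N).
Hypotheses (sge : simple_graph e) (rge : regular_graph e d).
Let mu : R := graph_mu R e.

(* Tanner's inequality |N(S)| >= d^2 s / (d^2 s / n + mu^2 (1 - s / n)),
   s = |S|, with denominators cleared. *)
Lemma neighborhood_expansion (S : {set 'I_n}) :
  d%:R ^+ 2 * #|S|%:R * n%:R <=
  #|neighborhood e S|%:R *
    (d%:R ^+ 2 * #|S|%:R + mu ^+ 2 * (n%:R - #|S|%:R)) :> R.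
Proof.
have n0 : 0 < n%:R :> R by rewrite ltr0n; case: (n) n_ge2.
have [S0|s_gt0] := posnP #|S|.
  rewrite S0 mulr0n mulr0 mul0r add0r subr0.
  by rewrite mulr_ge0 // mulr_ge0 ?sqr_ge0.
have s0 : 0 < #|S|%:R :> R by rewrite ltr0n.
pose A : 'M[R]_n := adjacency e R.
pose x : 'rV[R]_n := \row_i (i \in S)%:R.
have sx : \sum_i x 0 i = #|S|%:R.
  rewrite -sum1_card natr_sum [RHS]big_mkcond; apply: eq_bigr => i _.
  by rewrite mxE; case: (i \in S).
have sx2 : \sum_i x 0 i ^+ 2 = #|S|%:R.
  rewrite -sx; apply: eq_bigr => i _; rewrite mxE.
  by case: (i \in S); rewrite ?expr1n ?expr0n.
have sxA : \sum_i (x *m A) 0 i = d%:R * #|S|%:R.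
  under eq_bigr do rewrite mxE.
  rewrite exchange_big -sx mulr_sumr; apply: eq_bigr => i _.
  by rewrite -mulr_sumr (sum_adjacency_row R rge) mulrC.
(* [c] is the mean of the indicator [x] of [S], so [y] is the zero-sum part of [x]. *)
pose c := #|S|%:R / n%:R : R.
pose y := x - const_mx c.
have sumc a : \sum_(i < n) a = a * n%:R :> R.
  by rewrite sumr_const card_ord mulr_natr.
have yE i : y 0 i = x 0 i - c by rewrite !mxE.
have sy : \sum_i y 0 i = 0.
  rewrite (eq_bigr _ (fun i _ => yE i)) sumrB sx sumc /c.
  by field; exact: lt0r_neq0.
have sy2 : \sum_i y 0 i ^+ 2 = #|S|%:R - #|S|%:R ^+ 2 / n%:R.
  under eq_bigr do rewrite yE.
  rewrite sum_sqrB sx sx2 sumc mul1r /c.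
  by field; exact: lt0r_neq0.
have cA : const_mx c *m A = const_mx (c * d%:R) :> 'rV_n.
  apply/rowP => i; rewrite !mxE -(sum_adjacency_row R rge i) mulr_sumr.
  by apply: eq_bigr => j _; rewrite !mxE sge.1.
have yA i : (y *m A) 0 i = (x *m A) 0 i - c * d%:R.
  by rewrite mulmxBl cA !mxE.
have := graph_mu_sqnorm_le n_ge2 d_gt0 sge rge sy; rewrite -/A -/mu sy2.
under eq_bigr do rewrite yA.
rewrite sum_sqrB sxA sumc mul1r => le1.
have le2 : (\sum_i (x *m A) 0 i) ^+ 2 <=
    #|neighborhood e S|%:R * \sum_i (x *m A) 0 i ^+ 2.
  apply: sum_sqr_le_support => i; rewrite inE negb_exists_in => /forall_inP h.
  rewrite mxE big1 // => j _; rewrite !mxE -sge.1.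
  by have [/h/negPf ->|_] := boolP (j \in S); rewrite ?mulr0 ?mul0r.
set Q := \sum_i (x *m A) 0 i ^+ 2 in le1 le2.
rewrite sxA in le2.
(* This is [le1] multiplied by [n]: its left side equals [Q - d^2 |S|^2 / n]. *)
have le3 : n%:R * Q <= #|S|%:R *
    (d%:R ^+ 2 * #|S|%:R + mu ^+ 2 * (n%:R - #|S|%:R)).
  move: le1; rewrite -(ler_pM2l n0) -subr_ge0 -[in X in _ -> X]subr_ge0.
  congr (0 <= _); rewrite /c; field; exact: lt0r_neq0.
rewrite -(ler_pM2l s0).
have -> : #|S|%:R * (d%:R ^+ 2 * #|S|%:R * n%:R) = n%:R * (d%:R * #|S|%:R) ^+ 2 :> R.
  by ring.
apply: le_trans (_ : n%:R * (#|neighborhood e S|%:R * Q) <= _).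
  by rewrite ler_wpM2l // ltW.
by rewrite mulrCA [leRHS]mulrCA ler_wpM2l.
Qed.
End Expansion.

(** The bound [d2 s n / (d2 s + m2 (n - s))] is nondecreasing in [s], so [s] may be lowered to
    [delta * n]. *)
Lemma expansion_ratio_mono (R : realFieldType) (d2 m2 n s t delta : R) :
  0 <= m2 -> 0 < d2 -> 0 < delta -> delta * n <= s -> 0 < s -> s <= n -> 0 <= t ->
  d2 * s * n <= t * (d2 * s + m2 * (n - s)) ->
  d2 * delta * n / (delta * (d2 - m2) + m2) <= t.
Proof.
move=> m0 d0 de0 des s0 sn t0 h.
have n0 : 0 < n by apply: lt_le_trans sn.
have de1 : delta <= 1 by rewrite -(ler_pM2r n0) mul1r (le_trans des).
have den0 : 0 < delta * (d2 - m2) + m2.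
  (* Since [delta <= 1], the denominator is a convex combination of [d2 > 0] and [m2 >= 0]. *)
  have -> : delta * (d2 - m2) + m2 = delta * d2 + (1 - delta) * m2 by ring.
  by rewrite ltr_pwDl ?mulr_gt0 // mulr_ge0 // subr_ge0.
rewrite ler_pdivrMr // -(ler_pM2l s0).
apply: le_trans (_ : delta * (t * (d2 * s + m2 * (n - s))) <= _).
  rewrite (_ : s * _ = delta * (d2 * s * n)); last by ring.
  by rewrite ler_wpM2l // ltW.
rewrite -subr_ge0.
rewrite (_ : _ - _ = t * m2 * (s - delta * n)); last by ring.
by rewrite !mulr_ge0 // subr_ge0.
Qed.

(** * Distances and size of the expander code *)

Lemma has_min_dist_exists (K : finType) n (C : {set 'rV[K]_n}) x y :
  x \in C -> y \in C -> x != y -> exists D, has_min_dist C D.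
Proof.
move=> xC yC xy.
pose P (u : 'rV[K]_n * 'rV[K]_n) := [&& u.1 \in C, u.2 \in C & u.1 != u.2].
have Pxy : P (x, y) by rewrite /P /= xC yC.
case: (@arg_minnP _ (x, y) P (fun u => hamming_dist u.1 u.2) Pxy).
move=> [u v] /and3P [uC vC uv] min_uv; exists (hamming_dist u v); split.
  by exists u, v.
by move=> a b aC bC ab; apply: (min_uv (a, b)); apply/and3P.
Qed.

Lemma hamming_dist_gt0 (K : finType) n (x y : 'rV[K]_n) :
  x != y -> (0 < hamming_dist x y)%N.
Proof.
apply: contraNT; rewrite -eqn0Ngt cards_eq0 => /eqP S0.
apply/eqP/rowP => i; apply/eqP; apply: contraFT (in_set0 i).
by rewrite -S0 inE.
Qed.

(** As [theta] is injective, coordinate [i] changes exactly when some entry listed by [nbr i]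
    does. *)
Lemma hamming_dist_phi_exp (F L : finFieldType) n d (theta : 'rV[F]_d -> L)
    (e : rel 'I_n) (nbr : 'I_n -> d.-tuple 'I_n) (a b : 'rV[F]_n) :
  injective theta -> neighbor_order e nbr ->
  hamming_dist (phi_exp theta nbr a) (phi_exp theta nbr b) =
  #|neighborhood e [set j | a 0 j != b 0 j]|.
Proof.
move=> theta_inj hnbr; apply: eq_card => i; rewrite !inE !mxE.
rewrite (inj_eq theta_inj); apply/idP/exists_inP => [ne|[j]].
  have [k] : exists k, a 0 (tnth (nbr i) k) != b 0 (tnth (nbr i) k).
    apply/existsP; apply: contraNT ne; rewrite negb_exists => /forallP h.
    by apply/eqP/rowP => k; rewrite !mxE; apply/eqP; move: (h k); rewrite negbK.
  move=> ab; exists (tnth (nbr i) k); first by rewrite inE.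
  by rewrite -(hnbr i).2 mem_tnth.
rewrite inE => ab; rewrite -(hnbr i).2 => /tnthP [k jk].
apply: contraNneq ab => /rowP /(_ k); rewrite !mxE -jk => ->.
by rewrite eqxx.
Qed.

(* MathComp / MathComp-Analysis.  L is F_{q^d}, an F-vector space through emb;
   theta is an F-linear identification of F^d with L. *)
Theorem theorem4 (R : realType) (F L : finFieldType) (n d : nat)
  (emb : {rmorphism F -> L})
  (theta : {linear 'rV[F]_d -> L | emb \; *%R})
  (e : rel 'I_n) (nbr : 'I_n -> d.-tuple 'I_n)
  (C : {vspace 'rV[F]_n}) (k D : nat) (r0 delta0 : R) :
  (2 <= n)%N -> (1 <= d)%N ->
  #|L| = (#|F| ^ d)%N -> bijective theta ->
  simple_graph e -> regular_graph e d -> neighbor_order e nbr ->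
  k%:R = r0 * n%:R -> D%:R = delta0 * n%:R -> linear_code C k D ->
  let mu : R := graph_mu R e in
  let Cexp := expander_code theta nbr C in
  code_rate R Cexp = r0 / d%:R /\
  exists Dexp : nat, has_min_dist Cexp Dexp /\
    d%:R ^+ 2 * delta0 * n%:R
      / (delta0 * (d%:R ^+ 2 - mu ^+ 2) + mu ^+ 2) <= Dexp%:R.
Proof.
move=> n_ge2 d_gt0 cardL /bij_inj theta_inj sge rge hnbr kE DE [dimC minC] mu Cexp.
have [[x [y [xC yC xy xyD]]] minD] := minC; rewrite !inE in xC yC.
have D_gt0 : (0 < D)%N by rewrite -xyD hamming_dist_gt0.
have n0 : n%:R != 0 :> R by rewrite pnatr_eq0; case: (n) n_ge2.
have d0 : 0 < d%:R :> R by rewrite ltr0n.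
have ratio a b : a \in C -> b \in C -> a != b ->
    d%:R ^+ 2 * delta0 * n%:R
      / (delta0 * (d%:R ^+ 2 - mu ^+ 2) + mu ^+ 2) <=
    (hamming_dist (phi_exp theta nbr a) (phi_exp theta nbr b))%:R.
  move=> aC bC ab; rewrite (hamming_dist_phi_exp _ _ theta_inj hnbr).
  apply: expansion_ratio_mono (neighborhood_expansion R n_ge2 d_gt0 sge rge _).
  - exact: sqr_ge0.
  - exact: exprn_gt0.
  (* [delta0] is positive because the minimum distance [D] is attained by distinct words. *)
  - have : 0 < delta0 * n%:R by rewrite -DE ltr0n D_gt0.
    by rewrite pmulr_lgt0 // lt_def n0 ler0n.
  - by rewrite -DE ler_nat minD ?inE.
  - by rewrite ltr0n hamming_dist_gt0.
  - by rewrite ler_nat -[leqRHS]card_ord max_card.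
  - exact: ler0n.
(* If distinct words had equal images, a nonempty [S] would have an empty neighborhood, and
   expansion would give [d^2 |S| n <= 0]. *)
have phi_inj : injective (phi_exp theta nbr).
  move=> a b ab; apply/eqP; apply: contraT => /hamming_dist_gt0.
  have := neighborhood_expansion R n_ge2 d_gt0 sge rge [set j | a 0 j != b 0 j].
  rewrite -(hamming_dist_phi_exp _ _ theta_inj hnbr) ab.
  have -> : hamming_dist (phi_exp theta nbr b) (phi_exp theta nbr b) = 0%N.
    by apply/eqP; rewrite cards_eq0; apply/eqP/setP => i; rewrite !inE eqxx.
  rewrite mul0r -/(hamming_dist a b) => h s0; move: h; rewrite leNgt.
  by rewrite !mulr_gt0 ?exprn_gt0 // ?ltr0n // ltnW.
have cardC : #|Cexp| = (#|F| ^ k)%N.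
  by rewrite card_imset // card_vspace dimC.
split.
  (* With [|Cexp| = q^k] and [|L| = q^d], the factor [ln q] cancels and the rate is [k / (d n)]. *)
  have lnF : 0 < ln #|F|%:R :> R by rewrite ln_gt0 // ltr1n finNzRing_gt1.
  have F0 : 0 < #|F|%:R :> R by rewrite ltr0n ltnW // finNzRing_gt1.
  have lnX j : ln (#|F| ^ j)%N%:R = j%:R * ln #|F|%:R :> R.
    by rewrite (natrX R #|F| j) lnXn // mulr_natl.
  rewrite /code_rate cardC cardL !lnX kE.
  by field; rewrite n0 !lt0r_neq0.
have [Dexp minDexp] : exists D, has_min_dist Cexp D.
  apply: (@has_min_dist_exists _ _ _ (phi_exp theta nbr x) (phi_exp theta nbr y)).
  - exact: imset_f.
  - exact: imset_f.
  - by rewrite (inj_eq phi_inj).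
exists Dexp; split=> //.
(* [Dexp] is attained by two distinct images, whose preimages are distinct words of [C]. *)
have [[_ [_ [/imsetP [a aC ->] /imsetP [b bC ->] ab <-]]] _] := minDexp.
by apply: ratio => //; apply: contraNneq ab => ->.
Qed.
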